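(* Let $X$ be an $n\times n$ Hermitian random matrix whose entries $X_{ij}=(X_{ji})^*$ are independent for $i\ge j$, with $X_{ij}\sim N_{\mathbb{C}}(0,b_{ij}^2)$ for $i>j$ and $X_{ii}\sim N_{\mathbb{R}}(0,b_{ii}^2)$, where $b_{ij}=b_{ji}\ge 0$ are arbitrary nonnegative scalars. Let $$\sigma^2:=\max_{i\le n}\sum_{j\le n} b_{ij}^2,\qquad \sigma_*^2:=\max_{i,j\le n} b_{ij}^2,$$ and assume that $\sigma_*^2=1$ and $\sigma^2\le d\in\mathbb{N}$. Then $$\mathbf{E}[\mathrm{tr}\,X^{2p}]\le\mathbf{E}[\mathrm{tr}\,Y^{2p}]$$ for all $p\in\mathbb{N}$, where $Y$ is the $d\times d$ Hermitian matrix whose entries $Y_{ij}=(Y_{ji})^*$ are independent for $i\ge j$ with $Y_{ij}\sim N_{\mathbb{C}}(0,1)$ for $i>j$ and $Y_{ii}\sim N_{\mathbb{R}}(0,1)$.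
   Context: $N_{\mathbb{R}}(0,s^2)$ is the real centered Gaussian law with variance $s^2$. $N_{\mathbb{C}}(0,s^2)$ is the law of a complex random variable whose real and imaginary parts are independent with law $N_{\mathbb{R}}(0,s^2/2)$. For a scalar, $a^*$ is the complex conjugate. For a $k\times k$ matrix $M$, $\mathrm{tr}\,M:=\frac1k\sum_{i=1}^k M_{ii}$ denotes the normalized trace. *)

(* Defs.v *)
From HB Require Import structures.
From mathcomp Require Import all_boot all_order all_algebra.
From mathcomp Require Import complex.
From mathcomp Require Import all_classical all_reals all_analysis.

Set Implicit Arguments.
Unset Strict Implicit.
Unset Printing Implicit Defensive.

Import Order.TTheory GRing.Theory Num.Theory.
Import numFieldNormedType.Exports.

Local Open Scope classical_set_scope.
Local Open Scope ring_scope.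
Local Open Scope complex_scope.

(* N_R(0, v), parametrized by the variance v >= 0. The case v = 0 is a point
   mass at 0; it is separated because [normal_prob 0 0] is, by convention, the
   uniform law on [0, 1]. *)
Definition normalR (R : realType) (v : R) : set R -> \bar R :=
  if v == 0 then \d_(0 : R) else normal_prob (0 : R) (Num.sqrt v).

Section Gaussian.
Context (R : realType) (dT : measure_display) (T : measurableType dT).
Variable P : probability T R.

Definition has_law_NR (U : T -> R) (v : R) : Prop :=
  measurable_fun setT U /\
  forall A : set R, measurable A -> pushforward P U A = normalR v A.

Definition indep2 (U V : T -> R) : Prop :=
  forall A B : set R, measurable A -> measurable B ->
    P (U @^-1` A `&` V @^-1` B) = (P (U @^-1` A) * P (V @^-1` B))%E.

Definition has_law_NC (Z : T -> R[i]) (v : R) : Prop :=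
  [/\ has_law_NR (fun w => complex.Re (Z w)) (v / 2),
      has_law_NR (fun w => complex.Im (Z w)) (v / 2) &
      indep2 (fun w => complex.Re (Z w)) (fun w => complex.Im (Z w))].

(* C is identified with R * R and given the product (= Borel) sigma-algebra. *)
Definition complex_pair (z : R[i]) : R * R := (complex.Re z, complex.Im z).

Definition mutually_independent (I : finType) (D : {set I})
    (Z : I -> T -> R[i]) : Prop :=
  forall (J : {set I}) (A : I -> set (R * R)), J \subset D ->
    (forall i, measurable (A i)) ->
    P (\bigcap_(i in [set i | i \in J]) ((complex_pair \o Z i) @^-1` A i)) =
    (\prod_(i in J) P ((complex_pair \o Z i) @^-1` A i))%E.

Definition gaussian_hermitian (n : nat) (b : 'I_n -> 'I_n -> R)
    (X : T -> 'M[R[i]]_n) : Prop :=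
  [/\ forall w i j, X w i j = (X w j i)^*,
      mutually_independent [set ij : 'I_n * 'I_n | (ij.2 <= ij.1)%N]
        (fun ij w => X w ij.1 ij.2),
      forall i j : 'I_n, (j < i)%N ->
        has_law_NC (fun w => X w i j) (b i j ^+ 2) &
      (* the diagonal entries are real, by Hermitian symmetry *)
      forall i : 'I_n,
        has_law_NR (fun w => complex.Re (X w i i)) (b i i ^+ 2)].

End Gaussian.

Definition ntr (K : fieldType) (k : nat) (M : 'M[K]_k) : K :=
  k%:R^-1 * \tr M.

(* The quantities below are nonnegative, so 0 is a neutral start for the max. *)
Definition sigma2 (R : realType) (n : nat) (b : 'I_n -> 'I_n -> R) : R :=
  \big[Num.max/0]_(i < n) \sum_(j < n) b i j ^+ 2.

Definition sigma_star2 (R : realType) (n : nat) (b : 'I_n -> 'I_n -> R) : R :=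
  \big[Num.max/0]_(i < n) \big[Num.max/0]_(j < n) b i j ^+ 2.

(* For a Hermitian matrix, tr M^q is a real number, so that taking its real part
   in [Etr_pow] loses nothing. *)
Lemma Im_ntr_hermitian (R : realType) (n q : nat) (M : 'M[R[i]]_n) :
  (forall i j, M i j = (M j i)^*) -> complex.Im (ntr (M ^+ q)) = 0.
Proof.
move=> hM.
have hMT : (map_mx (@conjc R) M)^T = M.
  by apply/matrixP => i j; rewrite !mxE [RHS]hM.
have hq : (map_mx (@conjc R) (M ^+ q))^T = M ^+ q.
  elim: q => [|q IH]; first by rewrite expr0 map_mx1 trmx1.
  by rewrite exprS -mulmxE map_mxM trmx_mul IH hMT mulmxE -exprSr exprS.
have ht : (ntr (M ^+ q))^* = ntr (M ^+ q).
  rewrite /ntr rmorphM fmorphV rmorph_nat; congr (_ * _).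
  by rewrite -[in RHS]hq mxtrace_tr trace_map_mx.
case: (ntr _) ht => a c /= [] /eqP.
by rewrite eq_sym -addr_eq0 -mulr2n mulrn_eq0 /= => /eqP.
Qed.

(* E[tr M^q], as an extended real number. *)
Definition Etr_pow (R : realType) (dT : measure_display)
    (T : measurableType dT) (P : probability T R) (k : nat)
    (M : T -> 'M[R[i]]_k) (q : nat) : \bar R :=
  expectation P (fun w => complex.Re (ntr (M w ^+ q))).

(* Main.v *)
Require Import Defs.
From HB Require Import structures.
From mathcomp Require Import all_boot all_order all_algebra.
From mathcomp Require Import complex.
From mathcomp Require Import all_classical all_reals all_analysis.
From mathcomp Require Import measurable_realfun ring lra.

(** The entries of a Hermitian Gaussian matrix [X] with variance profile [b]
    satisfy E[X_ij X_kl] = b_ij^2 if (k, l) = (j, i), and 0 otherwise. Expanding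
    the trace over closed walks u_0, ..., u_m = u_0 and applying the Wick
    formula to each product of entries gives
      E[tr X^m] = 1/n \sum_p \sum_u \prod_((k, l) in p)
        b_(u_k u_(k+1))^2 [u_l = u_(k+1)] [u_(l+1) = u_k],
    where [p] runs over the pairings of the m steps of the walk
    ([Etr_pow_pairings]). The set of pairings depends on m only, so it suffices
    to compare [X] and [Y] pairing by pairing ([sum_pairing_weight_le]).

    A pairing identifies positions of the walk: the sum over u is a sum over
    labellings of the classes of identified positions. Label the classes in
    the order in which the walk meets them. The first one can be labelled in n
    ways. If step t leads to a position whose class has been met before, its
    label is already determined, and the weight of the step is at most 1
    because b_ij^2 <= 1. If it leads to a new class, then t is the earlier of
    its pair (the later step of a pair retraces the earlier one, so it only
    leads to a position already met); hence the step carries a weight b_(u_t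
    i)^2, and summing over the new label i gives at most d because the rows of
    b^2 sum to at most d. With N the number of classes, this bounds the sum by
    n d^(N-1). For [Y] each of these estimates is an equality, with n replaced
    by d. The normalization by 1/n and 1/d makes both sides comparable: at
    most d^(N-1) against exactly d^(N-1).

    The Wick formula is derived for the real coordinates of the matrix, which
    are independent real Gaussians ([gcoord_indep]): the moments of N(0, v)
    satisfy m_(k+1) = v k m_(k-1) by integration by parts
    ([has_law_NR_moment]), independence turns a moment of several coordinates
    into a product of moments ([expectation_prod_indep]), and multilinearity
    extends the resulting recursion to the complex entries
    ([word_moment_wick]). *)

Import Order.TTheory GRing.Theory Num.Theory.
Import numFieldNormedType.Exports.

Local Open Scope ring_scope.
Local Open Scope complex_scope.

Set Implicit Arguments.
Unset Strict Implicit.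
Unset Printing Implicit Defensive.

(** * Integration against a measure given by a density *)

Section density.
Local Open Scope classical_set_scope.
Local Open Scope ereal_scope.
Import HBNNSimple.
Context d d' (T : measurableType d) (S : measurableType d') (R : realType).
Variables (mu : {measure set T -> \bar R}) (nu : {measure set S -> \bar R}).
Variables (U : T -> S) (h : T -> R).
Hypothesis mU : measurable_fun setT U.
Hypothesis mh : measurable_fun setT h.
Hypothesis h0 : forall x, (0 <= h x)%R.
Hypothesis nuE : forall A, measurable A ->
  nu A = \int[mu]_(x in U @^-1` A) (h x)%:E.

Let mhE : measurable_fun setT (EFin \o h).
Proof. exact/measurable_EFinP. Qed.

(** Both sides agree for simple functions by the assumption on [nu], and pass
    to the limit by monotone convergence. This one statement serves twice:
    with [U] the identity and [h] the Gaussian density, and with [U] a random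
    variable and [h] a product of variables independent of it. *)
Lemma ge0_integral_density (f : S -> R) : measurable_fun setT f ->
  (forall y, 0 <= f y)%R ->
  \int[nu]_y (f y)%:E = \int[mu]_x ((f (U x) * h x)%R)%:E.
Proof.
move=> mf f0.
have mfE : measurable_fun setT (EFin \o f) by exact/measurable_EFinP.
pose g := nnsfun_approx measurableT mfE.
have g_nd y : {homo (fun n => g n y) : m n / (m <= n)%N >-> (m <= n)%R}.
  by move=> m n mn; exact/lefP/nd_nnsfun_approx.
have g_cvg y : (g n y)%:E @[n --> \oo] --> (f y)%:E.
  by apply: (cvg_nnsfun_approx measurableT mfE) => // z _; rewrite lee_fin.
have mgU n : measurable_fun setT (fun x => g n (U x)).
  exact: (measurableT_comp (@measurable_funPT _ _ _ _ (g n)) mU).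
transitivity (limn (fun n => \int[nu]_y (g n y)%:E)).
  rewrite -monotone_convergence//.
  - by apply: eq_integral => y _; apply/esym/cvg_lim => //; exact: g_cvg.
  - by move=> n; exact/measurable_EFinP.
  - by move=> n y _; rewrite lee_fin.
  - by move=> y _ m n mn; rewrite lee_fin; exact: g_nd.
transitivity (limn (fun n => \int[mu]_x (g n (U x) * h x)%:E)); last first.
  rewrite -monotone_convergence//.
  - apply: eq_integral => x _; apply/cvg_lim => //.
    under eq_fun do rewrite EFinM.
    by rewrite EFinM; apply: cvgeZr => //; exact: g_cvg.
  - by move=> n; apply/measurable_EFinP/measurable_funM.
  - by move=> n y _; rewrite lee_fin mulr_ge0.
  - by move=> y _ m n mn; rewrite lee_fin ler_wpM2r//; exact: g_nd.
congr (limn _); apply/funext => n.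
have mpre r : measurable (U @^-1` (g n @^-1` [set r])).
  by rewrite -[X in measurable X]setTI; apply: mU.
transitivity (\sum_(r \in range (g n)) r%:E * nu (g n @^-1` [set r])).
  under eq_integral do rewrite fimfunE -fsumEFin//.
  rewrite ge0_integral_fsum//; last 2 first.
  - by move=> r; exact/measurable_EFinP/measurable_funM.
  - by move=> r x _; rewrite nnfun_muleindic_ge0.
  apply: eq_fsbigr => r _; rewrite integralZl_indic_nnsfun//.
  by rewrite integral_indic//= setIT.
under [RHS]eq_integral.
  move=> x _; rewrite fimfunE EFinM -fsumEFin// ge0_mule_fsuml; last first.
    by move=> r; rewrite nnfun_muleindic_ge0.
  over.
rewrite ge0_integral_fsum//; last 2 first.
- move=> r; apply: emeasurable_funM => //.
  apply/measurable_EFinP/measurable_funM => //=.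
  exact: (measurableT_comp _ mU).
- by move=> r x _; rewrite mule_ge0 ?nnfun_muleindic_ge0// lee_fin.
apply: eq_fsbigr => r; rewrite inE => -[z _ <-].
under eq_integral do rewrite EFinM -muleA.
rewrite ge0_integralZl//; last 3 first.
- apply: emeasurable_funM => //; apply/measurable_EFinP.
  exact: (measurableT_comp _ mU).
- by move=> x _; rewrite mule_ge0// lee_fin.
- by rewrite lee_fin.
congr (_ * _); rewrite nuE// integral_mkcond; apply: eq_integral => x _.
rewrite patchE indicE /=.
have -> : (x \in U @^-1` (g n @^-1` [set g n z])) =
    (U x \in g n @^-1` [set g n z]).
  by apply/idP/idP; rewrite !inE.
by case: ifP; rewrite ?mul1e ?mul0e.
Qed.

Lemma integral_density (f : S -> R) : measurable_fun setT f ->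
  \int[nu]_y (f y)%:E = \int[mu]_x ((f (U x) * h x)%R)%:E.
Proof.
move=> mf; rewrite integralE [RHS]integralE; congr (_ - _).
- under eq_integral do rewrite funeposE -EFin_max.
  rewrite ge0_integral_density; last 2 first.
  + exact: measurable_maxr.
  + by move=> y; rewrite le_max lexx orbT.
  apply: eq_integral => x _; rewrite funeposE -EFin_max; congr EFin.
  by rewrite maxr_pMl// mul0r.
- under eq_integral do rewrite funenegE -EFinN -EFin_max.
  rewrite ge0_integral_density; last 2 first.
  + by apply: measurable_maxr => //; exact: measurableT_comp.
  + by move=> y; rewrite le_max lexx orbT.
  apply: eq_integral => x _; rewrite funenegE -EFinN -EFin_max; congr EFin.
  by rewrite maxr_pMl// mul0r mulNr.
Qed.

Lemma integrable_density (f : S -> R) : measurable_fun setT f ->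
  nu.-integrable setT (EFin \o f) <->
  mu.-integrable setT (fun x => ((f (U x) * h x)%R)%:E).
Proof.
move=> mf.
have mfUh : measurable_fun setT (fun x => ((f (U x) * h x)%R)%:E).
  by apply/measurable_EFinP/measurable_funM => //; exact: measurableT_comp.
have E : \int[nu]_y `|(EFin \o f) y| = \int[mu]_x `|((f (U x) * h x)%R)%:E|.
  under eq_integral do rewrite /= -abse_EFin.
  rewrite /= (@ge0_integral_density (fun y => `|f y|%R))//.
    by apply: eq_integral => x _; rewrite /= normrM (ger0_norm (h0 x)).
  exact: measurableT_comp.
split=> /integrableP[_ foo]; apply/integrableP; split => //.
- by rewrite -E.
- exact/measurable_EFinP.
- by rewrite E.
Qed.
End density.

(** The measure structure of an image measure depends on a proof that the map
    is measurable; this packages the two. *)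
Lemma pushforward_measure d d' (T : measurableType d) (S : measurableType d')
    (R : realType) (mu : {measure set T -> \bar R}) (U : T -> S) :
  measurable_fun setT U ->
  {nu : {measure set S -> \bar R} | nu = pushforward mu U :> (_ -> _)}.
Proof.
move=> mU.
by exists (measure_function_pushforward__canonical__measure_function_Measure
  mu mU).
Qed.

(** * Moments of centered real Gaussian variables *)

Section moments.
Local Open Scope classical_set_scope.
Context {R : realType}.
Local Notation mu := (@lebesgue_measure R).
Local Notation phi s := (normal_pdf (0 : R) s).

(** On [-n, n] the integral is F n - F (- n); let n tend to infinity, using
    dominated convergence on the left. *)
Lemma integral_derivative_eq0 (F f : R -> R) :
  (forall x : R, is_derive x 1 F (f x)) -> continuous f ->
  mu.-integrable setT (EFin \o f) ->
  F n%:R @[n --> \oo] --> 0 -> F (- n%:R) @[n --> \oo] --> 0 ->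
  (\int[mu]_x (f x)%:E = 0)%E.
Proof.
move=> dF cf intf Fy FNy.
pose J (n : nat) : set R := `[(- n.+1%:R)%R, n.+1%:R].
have mf : measurable_fun [set: R] f.
  by apply/measurable_EFinP; exact: (measurable_int mu intf).
have IJ n : (\int[mu]_(x in J n) (f x)%:E = (F n.+1%:R - F (- n.+1%:R))%:E)%E.
  rewrite EFinB; apply: continuous_FTC2.
  - by rewrite (@lt_trans _ _ 0)// oppr_lt0.
  - exact: continuous_subspaceT.
  - have cF : continuous F.
      move=> x; apply/differentiable_continuous/derivable1_diffP.
      by case: (dF x).
    split.
    + by move=> x _; case: (dF x).
    + by apply: cvg_at_right_filter; exact: cF.
    + by apply: cvg_at_left_filter; exact: cF.
  - by move=> x _; rewrite derive1E derive_val.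
have c1 : (\int[mu]_(x in J n) (f x)%:E)%E @[n --> \oo] --> 0%E.
  under eq_fun do rewrite IJ.
  apply: cvg_EFin; first exact: nearW.
  rewrite -[X in _ --> X](subr0 (0 : R)).
  apply: (@cvgB _ R^o).
    by move: Fy; rewrite -(cvg_shiftS (fun n : nat => F n%:R)).
  by move: FNy; rewrite -(cvg_shiftS (fun n : nat => F (- n%:R))).
have c2 : (\int[mu]_(x in J n) (f x)%:E)%E @[n --> \oo] -->
    (\int[mu]_x (f x)%:E)%E.
  under eq_fun do rewrite integral_mkcond.
  have mfJ n : measurable_fun setT ((EFin \o f) \_ (J n)).
    apply: (measurable_restrictT _ _).1; first exact: measurable_itv.
    by apply: measurable_funTS; exact/measurable_EFinP.
  have mfE : measurable_fun setT (EFin \o f) by exact/measurable_EFinP.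
  have cvgJ : {ae mu, forall x, setT x ->
      ((EFin \o f) \_ (J n)) x @[n --> \oo] --> (EFin \o f) x}.
    apply: aeW => x _; apply: cvg_near_cst.
    have [N _ Nx] : \forall n \near \oo, `|x| <= n%:R by exact: nbhs_infty_ger.
    exists N => // n /= Nn; rewrite patchE mem_set// /J /= in_itv/= -ler_norml.
    by rewrite (le_trans (Nx _ Nn))// ler_nat.
  have domJ : {ae mu, forall x n, setT x ->
      (`|((EFin \o f) \_ (J n)) x| <= (abse \o (EFin \o f)) x)%E}.
    apply: aeW => x n _; rewrite patchE; case: ifPn => //= _.
    by rewrite normr0 lee_fin.
  by have [] := @dominated_convergence _ _ R mu setT measurableT _ _ _
    mfJ mfE cvgJ (integrable_abse intf) domJ.
exact: cvg_unique c2 c1.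
Qed.

Lemma measurable_exprX k : measurable_fun [set: R] (fun x : R => x ^+ k).
Proof. exact: measurable_funX. Qed.

(** A power of [x] is absorbed by half of the Gaussian exponent; what remains
    is, up to a constant, the density with twice the variance. Integrability
    and decay at infinity of all x^k phi(x) follow. *)
Lemma expr_normal_pdf_le (s : R) k : s != 0 -> exists C : R, forall x,
  `|x ^+ k * phi s x| <= C * phi (s * Num.sqrt 2) x.
Proof.
move=> s0.
have s2 : s * Num.sqrt 2 != 0 by rewrite mulf_neq0// sqrtr_eq0 -ltNge.
(* (x^2)^k = (4 s^2)^k q^k, where q is defined below, and q^k <= k! exp q *)
pose C0 : R := 1 + (4 * s ^+ 2) ^+ k * k`!%:R.
have ss : 0 < s ^+ 2 by rewrite exprn_even_gt0.
have p0 := normal_peak_gt0 s0; have p1 := normal_peak_gt0 s2.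
exists (C0 * normal_peak s / normal_peak (s * Num.sqrt 2)) => x.
rewrite !normal_pdfE//=.
rewrite [leRHS]mulrA divfK ?gt_eqF// mulrCA normrM (ger0_norm (ltW p0)).
rewrite (mulrC C0) -[leRHS]mulrA ler_pM2l// /normal_fun subr0 exprMn.
rewrite sqr_sqrtr//.
set q := x ^+ 2 / (4 * s ^+ 2).
have -> : - x ^+ 2 / (s ^+ 2 *+ 2) = - (q + q) by rewrite /q; field.
have -> : - x ^+ 2 / (s ^+ 2 * 2 *+ 2) = - q by rewrite /q; field.
rewrite opprD expRD mulrA normrM (ger0_norm (expR_ge0 _)) ler_pM2r ?expR_gt0//.
rewrite expRN normrM normfV (ger0_norm (expR_ge0 _)) ler_pdivrMr ?expR_gt0//.
have q0 : 0 <= q by rewrite divr_ge0 ?sqr_ge0// mulr_ge0// ltW.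
have e1 : 1 <= expR q by rewrite -expR0 ler_expR.
have xq : x ^+ 2 = 4 * s ^+ 2 * q by rewrite /q; field.
have qk : q ^+ k <= k`!%:R * expR q.
  case: k {C0} => [|k]; first by rewrite mul1r.
  rewrite mulrC -ler_pdivrMr ?ltr0n ?fact_gt0//.
  by rewrite (le_trans _ (expR_ge1Dxn k q0))// -[leLHS]add0r lerD2r.
have h1 : `|x ^+ k| <= 1 + (x ^+ 2) ^+ k.
  rewrite -exprM mulnC exprM -[(x ^+ k) ^+ 2]real_normK ?num_real//.
  have := sqr_ge0 (`|x ^+ k| - 1); have := normr_ge0 (x ^+ k).
  by set y := `|_|; nra.
apply: (le_trans h1); rewrite xq exprMn /C0 [leRHS]mulrDl mul1r lerD// -mulrA.
by rewrite ler_wpM2l// exprn_ge0// mulr_ge0// ltW.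
Qed.

Lemma measurable_expr_normal_pdf (s : R) k :
  measurable_fun [set: R] (fun x => x ^+ k * phi s x).
Proof.
by apply: measurable_funM; [exact: measurable_exprX|exact: measurable_normal_pdf].
Qed.

Lemma integrable_expr_normal_pdf (s : R) k : s != 0 ->
  mu.-integrable setT (fun x => (x ^+ k * phi s x)%:E).
Proof.
move=> s0; have [C leC] := expr_normal_pdf_le k s0.
apply: (@le_integrable _ _ _ mu _ measurableT _
   (fun x => C%:E * (phi (s * Num.sqrt 2) x)%:E)%E).
- apply: measurable_funTS; apply/measurable_EFinP.
  exact: measurable_expr_normal_pdf.
- move=> x _; rewrite -EFinM /= lee_fin (le_trans (leC x))//.
  exact: ler_norm.
- by apply: integrableZl => //; exact: integrable_normal_pdf.
Qed.

Lemma cvg_expr_normal_pdf (s : R) k (u : nat -> R) : s != 0 ->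
  (forall n, `|u n| = n%:R) ->
  u n ^+ k * phi s (u n) @[n --> \oo] --> 0.
Proof.
move=> s0 uE; have [C leC] := expr_normal_pdf_le k.+1 s0.
have s2 : s * Num.sqrt 2 != 0 by rewrite mulf_neq0// sqrtr_eq0 -ltNge.
pose D := C * normal_peak (s * Num.sqrt 2).
have C0 : 0 <= C.
  have := le_trans (normr_ge0 _) (leC 0).
  rewrite pmulr_lge0// normal_pdfE//=.
  by rewrite mulr_gt0// ?normal_peak_gt0// /normal_fun expR_gt0.
have D0 : 0 <= D by rewrite mulr_ge0// ltW// normal_peak_gt0.
have leD x : `|x ^+ k.+1 * phi s x| <= D.
  by rewrite (le_trans (leC x))// ler_wpM2l//; exact: normal_pdf_ub.
(* bounding the next power by D bounds the k-th one by D / n *)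
apply/cvgrPdist_le => /= e e0; near=> n.
have n0 : 0 < n%:R :> R by rewrite ltr0n; near: n; exact: nbhs_infty_gt.
rewrite sub0r normrN -(ler_pM2l n0) -(uE n) -normrM mulrA -exprS.
rewrite (le_trans (leD _))// uE -ler_pdivrMr//.
by near: n; exact: nbhs_infty_ger.
Unshelve. all: by end_near. Qed.

Lemma is_derive_normal_pdf (s x : R) : s != 0 ->
  is_derive x 1 (phi s) (- (x / s ^+ 2) * phi s x).
Proof.
move=> s0; rewrite !normal_pdfE//= /normal_fun.
have -> : (fun x0 : R => normal_peak s * expR (- (x0 - 0) ^+ 2 / (s ^+ 2 *+ 2)))
   = (fun x0 => normal_peak s *: expR ((- (s ^+ 2 *+ 2)^-1) *: (x0 ^+ 2))).
  apply/funext => y; rewrite subr0 /GRing.scale/=; congr (_ * expR _).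
  by rewrite mulrC mulrN mulNr.
apply: is_derive_eq.
rewrite /GRing.scale/= subr0 !mulr1.
have -> : - (s ^+ 2 *+ 2)^-1 * x ^+ 2 = - x ^+ 2 / (s ^+ 2 *+ 2) by ring.
by field.
Qed.

Lemma is_derive_expr_normal_pdf (s : R) k (x : R) : s != 0 ->
  is_derive x 1 (fun x => x ^+ k * phi s x)
   (k%:R * x ^+ k.-1 * phi s x - (s ^+ 2)^-1 * (x ^+ k.+1 * phi s x)).
Proof.
move=> s0; have d1 := is_derive_normal_pdf x s0.
have d2 : is_derive x 1 (fun x : R => x ^+ k) (k%:R * x ^+ k.-1).
  apply: DeriveDef; first exact: exprn_derivable.
  by rewrite exp_derive /GRing.scale/= mulr1.
have /= := @is_deriveM _ _ _ _ x 1 _ _ d2 d1.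
move=> dM; refine (@is_derive_eq _ _ _ _ _ _ _ _ dM _).
by rewrite /GRing.scale/= (exprS x k); field.
Qed.

(** Integration by parts: the derivative of x^k phi(x) has integral 0. For k =
    0 the factor k on the right-hand side vanishes. *)
Lemma integral_expr_normal_pdf_rec (s : R) k : s != 0 ->
  (\int[mu]_x (x ^+ k.+1 * phi s x)%:E =
   (s ^+ 2 * k%:R)%:E * \int[mu]_x (x ^+ k.-1 * phi s x)%:E)%E.
Proof.
move=> s0.
have i1 := integrable_expr_normal_pdf k.+1 s0.
have i2 := integrable_expr_normal_pdf k.-1 s0.
have ss : s ^+ 2 != 0 by rewrite expf_neq0.
pose f x : R :=
  k%:R * x ^+ k.-1 * phi s x - (s ^+ 2)^-1 * (x ^+ k.+1 * phi s x).
have fE : EFin \o f = (fun x => k%:R%:E * (x ^+ k.-1 * phi s x)%:E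
     - (s ^+ 2)^-1%:E * (x ^+ k.+1 * phi s x)%:E)%E.
  by apply/funext => x; rewrite /f /= EFinB -!EFinM -mulrA.
have cX j : continuous (fun x : R => x ^+ j * phi s x).
  move=> x; apply/differentiable_continuous/derivable1_diffP.
  by case: (is_derive_expr_normal_pdf j x s0).
have iE1 := integrableZl measurableT k%:R i2.
have iE2 := integrableZl measurableT (s ^+ 2)^-1 i1.
have : (\int[mu]_x (EFin \o f) x = 0)%E.
  apply: (@integral_derivative_eq0 (fun x => x ^+ k * phi s x)).
  - by move=> x; exact: is_derive_expr_normal_pdf.
  - move=> x; apply: cvgB.
      under eq_fun do rewrite -mulrA.
      by rewrite -mulrA; apply: cvgM; [exact: cvg_cst|exact: cX].
    by apply: cvgM; [exact: cvg_cst|exact: cX].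
  - by rewrite fE; exact: integrableB.
  - by apply: cvg_expr_normal_pdf => // n; rewrite ger0_norm.
  - by apply: cvg_expr_normal_pdf => // n; rewrite normrN ger0_norm.
rewrite fE integralB// !integralZl//.
have := integrable_fin_num measurableT i1.
have := integrable_fin_num measurableT i2.
case: (integral _ _ _) => //= r _; case: (integral _ _ _) => //= r' _ [].
move/eqP; rewrite subr_eq0 => /eqP h; congr EFin.
by rewrite -mulrA h mulrA divff// mul1r.
Qed.

(** The k-th moment of N(0, v), v >= 0. *)
Fixpoint gauss_moment (v : R) (k : nat) : R :=
  if k is k'.+1 then
    if k' is k''.+1 then v * k'%:R * gauss_moment v k'' else 0
  else 1.

Lemma gauss_moment_rec v k :
  gauss_moment v k.+1 = v * k%:R * gauss_moment v k.-1.
Proof. by case: k => [|k] //=; rewrite mulr0 mul0r. Qed.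

Lemma integral_expr_normal_pdf (s : R) k : s != 0 ->
  (\int[mu]_x (x ^+ k * phi s x)%:E = (gauss_moment (s ^+ 2) k)%:E)%E.
Proof.
move=> s0; elim/ltn_ind: k => -[_|k IH].
  by under eq_integral do rewrite mul1r; exact: integral_normal_pdf.
by rewrite integral_expr_normal_pdf_rec// IH ?gauss_moment_rec// ltnS leq_pred.
Qed.
End moments.

Section law.
Local Open Scope classical_set_scope.
Context {R : realType} d (T : measurableType d) (P : probability T R).

Lemma has_law_NR_moment (U : T -> R) (v : R) k : 0 <= v -> has_law_NR P U v ->
  P.-integrable setT (fun w => (U w ^+ k)%:E) /\
  (\int[P]_w (U w ^+ k)%:E = (gauss_moment v k)%:E)%E.
Proof.
move=> v0 [mU lawU].
pose f (x : R) := x ^+ k.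
have mf : measurable_fun setT f by exact: measurable_exprX.
have mE : measurable_fun setT (fun w => (U w ^+ k)%:E).
  by apply/measurable_EFinP; exact: (measurableT_comp mf mU).
have mN : measurable_fun [set: R] (EFin \o (fun x => `|f x|)).
  by apply/measurable_EFinP; exact: measurableT_comp.
have [nu nuE] := pushforward_measure P mU.
suff [I1 I2] : (\int[nu]_x `|(f x)%:E| < +oo)%E /\
    (\int[nu]_x (f x)%:E = (gauss_moment v k)%:E)%E.
  have iU : P.-integrable setT (fun w => (U w ^+ k)%:E).
    apply/integrableP; split => //.
    by move: I1; rewrite nuE ge0_integral_pushforward.
  split => //; rewrite -I2 nuE integral_pushforward//.
  exact/measurable_EFinP.
(* for v = 0 the law is a point mass, not the density with parameter 0 *)
have [v00|vn0] := eqVneq v 0.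
  have lawE (A : set R) : measurable A -> nu A = (\d_(0 : R)) A.
    by rewrite nuE => /lawU; rewrite /normalR v00 eqxx.
  have intE (g : R -> \bar R) :
      (\int[nu]_x g x = \int[\d_(0%R:R)]_x g x)%E.
    by apply: eq_measure_integral => A mA _; exact: lawE.
  rewrite !intE.
  rewrite !integral_dirac//; last exact/measurable_EFinP.
  rewrite diracT !mul1e v00 /f; split; first by rewrite /= ltry.
  by case: k {f mf mE mN} => [|[|k]] //=; rewrite expr0n/= !mul0r.
pose s := Num.sqrt v.
have s0 : s != 0 by rewrite sqrtr_eq0 -ltNge lt0r vn0.
have mp := @measurable_normal_pdf R 0 s.
have p0 := @normal_pdf_ge0 R 0 s.
have E A : measurable A -> nu A =
    (\int[lebesgue_measure]_(x in id @^-1` A) (normal_pdf 0%R s x)%:E)%E.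
  by rewrite nuE => /lawU; rewrite /normalR (negbTE vn0).
have mid : measurable_fun [set: R] id by exact: measurable_id.
have := @integrable_density _ _ _ _ R (@lebesgue_measure R) nu id _
  mid mp p0 E f mf.
move=> [_ /(_ (integrable_expr_normal_pdf k s0)) /integrableP[_ I1]].
split => //.
rewrite (@integral_density _ _ _ _ R (@lebesgue_measure R) nu id _
  mid mp p0 E f mf).
by rewrite integral_expr_normal_pdf// sqr_sqrtr.
Qed.
End law.

(** * Expectation of a product of independent factors *)

Section independence.
Local Open Scope classical_set_scope.
Context {R : realType} d (T : measurableType d) (P : probability T R).
Variables (I : finType) (g : I -> T -> R).
Hypothesis mg : forall i, measurable_fun setT (g i).
Hypothesis indep : forall A : I -> set R, (forall i, measurable (A i)) ->
  P [set w | forall i, A i (g i w)] = (\prod_i P (g i @^-1` A i))%E.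

Let mgA i (A : set R) : measurable A -> measurable (g i @^-1` A).
Proof. by move=> mA; rewrite -[X in measurable X]setTI; exact: mg. Qed.

Lemma measurable_prod_indep (f : I -> R -> R) (Q : pred I) :
  (forall i, measurable_fun setT (f i)) ->
  measurable_fun setT (fun w => \prod_(i | Q i) f i (g i w)).
Proof.
move=> mf; under eq_fun do rewrite -big_filter.
by apply: measurable_prod => i _; exact: (measurableT_comp (mf i) (mg i)).
Qed.

(** Indicators are replaced by the [f i] one index at a time; the induction is
    on a list of the indices at which [f] need not be an indicator. Let h be
    the product over the indices other than the current one, k. By induction,
    A |-> E[h 1_A(g k)] is a multiple of the law of [g k]; integrating [f k]
    against this measure gives the product rule with [f k] in place of 1_A. *)
Lemma ge0_expectation_prod_indep (f : I -> R -> R) (m : I -> R) :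
  (forall i, measurable_fun setT (f i)) -> (forall i x, 0 <= f i x) ->
  (forall i, \int[P]_w (f i (g i w))%:E = (m i)%:E)%E ->
  (\int[P]_w (\prod_i f i (g i w))%:E = (\prod_i m i)%:E)%E.
Proof.
move=> mf f0 fm.
have : forall i, i \notin enum I -> exists A : set R,
  measurable A /\ f i = \1_A by move=> i; rewrite mem_enum.
elim: (enum I) f m mf f0 fm => [|k s IH] f m mf f0 fm find.
  have /choice[A HA] : forall i, exists A : set R, measurable A /\ f i = \1_A.
    by move=> i; exact: find.
  have PE i : P (g i @^-1` A i) = (m i)%:E.
    rewrite -fm; have [mA ->] := HA i.
    rewrite (eq_integral (fun w => (\1_(g i @^-1` A i) w)%:E)) => [|w _].
      by rewrite integral_indic// ?setIT//; exact: mgA.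
    by rewrite !indicE; congr (_%:R%:E); apply/idP/idP; rewrite !inE.
  rewrite (eq_integral (fun w => (\1_[set w | forall i, A i (g i w)] w)%:E)).
    rewrite integral_indic//; last first.
      have -> : [set w | forall i, A i (g i w)] =
          \bigcap_(i in setT) (g i @^-1` A i).
        by apply/seteqP; split => w /= H i; [move=> _; exact: H|exact: H].
      apply: fin_bigcap_measurable => [|i _]; first exact: finite_finset.
      by apply: mgA; have [] := HA i.
    rewrite setIT; apply: etrans (@indep A _) _.
      by move=> i; have [] := HA i.
    rewrite (eq_bigr _ (fun i _ => PE i)).
    by elim/big_rec2 : _ => // i x y _ ->.
  move=> w _; congr EFin; rewrite indicE.
  under eq_bigr => i _.
    have [_ ->] := HA i; rewrite indicE; over.
  have [/asboolP H|/asboolP H] := boolP `[< forall i, A i (g i w) >].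
    rewrite mem_set//= big1// => i _; rewrite mem_set//; exact: H.
  rewrite memNset//=; move/existsNP : H => [i Hi].
  by rewrite (bigD1 i)//= memNset// mul0r.
have m0 i : 0 <= m i.
  by rewrite -lee_fin -fm; apply: integral_ge0 => w _; rewrite lee_fin.
have C0 : 0 <= \prod_(i | i != k) m i by exact: prodr_ge0.
pose h w := \prod_(i | i != k) f i (g i w).
have mh : measurable_fun setT h by exact: measurable_prod_indep.
have h0 w : 0 <= h w by exact: prodr_ge0.
have [mu muE] := pushforward_measure P (mg k).
pose nu : {measure set R -> \bar R} := mscale (NngNum C0) mu.
have nuE A : measurable A -> nu A = (\int[P]_(w in g k @^-1` A) (h w)%:E)%E.
  move=> mA; pose fA i : R -> R := if i == k then \1_A else f i.
  pose mA' i : R := if i == k then fine (P (g k @^-1` A)) else m i.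
  have := IH fA mA'; rewrite [in X in _ -> X]integral_mkcond.
  have PA : (fine (P (g k @^-1` A)))%:E = P (g k @^-1` A).
    by rewrite fineK// fin_num_measure//; exact: mgA.
  have -> : \prod_i mA' i = fine (P (g k @^-1` A)) * \prod_(i | i != k) m i.
    rewrite (bigD1 k)//= /mA' eqxx; congr (_ * _).
    by apply: eq_bigr => i /negbTE ->.
  have nuA : nu A = (P (g k @^-1` A) * (\prod_(i | i != k) m i)%:E)%E.
    by rewrite muleC -[P (g k @^-1` A)]/(pushforward P (g k) A) -muE.
  rewrite EFinM PA -nuA => <-; last 4 first.
  - by move=> i; rewrite /fA; case: ifP => _.
  - by move=> i x; rewrite /fA; case: ifP => _ //; rewrite indicE.
  - move=> i; rewrite /fA /mA'; case: eqP => [->|_]//.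
    rewrite PA (eq_integral (fun w => (\1_(g k @^-1` A) w)%:E)) => [|w _].
      by rewrite integral_indic// ?setIT//; exact: mgA.
    by rewrite !indicE; congr (_%:R%:E); apply/idP/idP; rewrite !inE.
  - move=> i; rewrite /fA; case: eqP => [->|/eqP ik] iks; first by exists A.
    by apply: find; rewrite inE negb_or ik.
  apply: eq_integral => w _; rewrite patchE (bigD1 k)//= {1}/fA eqxx indicE.
  rewrite (_ : \prod_(i | i != k) fA i (g i w) = h w); last first.
    by apply: eq_bigr => i /negbTE ik; rewrite /fA ik.
  have -> : (w \in g k @^-1` A) = (g k w \in A) by apply/idP/idP; rewrite !inE.
  by case: ifP => _; rewrite ?mul1r ?mul0r.
have := ge0_integral_density (mg k) mh h0 nuE (mf k) (f0 k).
rewrite ge0_integral_mscale//; last 2 first.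
- exact/measurable_EFinP.
- by move=> x _; rewrite lee_fin.
rewrite muE ge0_integral_pushforward//; last 2 first.
- exact/measurable_EFinP.
- by move=> x _; rewrite lee_fin.
rewrite preimage_setT /= (fm k) -EFinM => H.
rewrite (bigD1 k)//= mulrC H; apply: eq_integral => w _.
by rewrite (bigD1 k).
Qed.

Lemma integrable_prod_indep (f : I -> R -> R) :
  (forall i, measurable_fun setT (f i)) ->
  (forall i, P.-integrable setT (fun w => (f i (g i w))%:E)) ->
  P.-integrable setT (fun w => (\prod_i f i (g i w))%:E).
Proof.
move=> mf fi; apply/integrableP; split.
  by apply/measurable_EFinP; exact: measurable_prod_indep.
under eq_integral do rewrite /= normr_prod.
have fin i : (\int[P]_w `|f i (g i w)|%:E \is a fin_num)%E.
  exact: integrable_fin_num (integrable_abse (fi i)).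
rewrite (@ge0_expectation_prod_indep (fun i x => `|f i x|)
  (fun i => fine (\int[P]_w `|f i (g i w)|%:E)))// ?ltry//.
- by move=> i; exact: measurableT_comp.
- by move=> i; rewrite fineK.
Qed.

(** The sign restriction is removed one index at a time by splitting [f k]
    into its positive and negative parts. *)
Lemma expectation_prod_indep (f : I -> R -> R) :
  (forall i, measurable_fun setT (f i)) ->
  (forall i, P.-integrable setT (fun w => (f i (g i w))%:E)) ->
  (\int[P]_w (\prod_i f i (g i w)) = \prod_i \int[P]_w (f i (g i w)))%R.
Proof.
move=> mf fi.
have : forall i, i \notin enum I -> forall x, 0 <= f i x.
  by move=> i; rewrite mem_enum.
elim: (enum I) f mf fi => [|k s IH] f mf fi f0.
  rewrite /Rintegral (@ge0_expectation_prod_indep f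
    (fun i => fine (\int[P]_w (f i (g i w))%:E)))//.
  - by move=> i x; exact: f0.
  - by move=> i; rewrite fineK//; exact: integrable_fin_num.
pose fp x := Num.max (f k x) 0; pose fn x := Num.max (- f k x) 0.
have fE x : f k x = fp x - fn x.
  by rewrite /fp /fn; case: (leP 0 (f k x)) => h; case: leP => h'; lra.
pose upd (u : R -> R) i : R -> R := if i == k then u else f i.
have mfp : measurable_fun setT fp by exact: measurable_maxr.
have mfn : measurable_fun setT fn.
  by apply: measurable_maxr => //; exact: measurableT_comp.
have ifp : P.-integrable setT (fun w => (fp (g k w))%:E).
  apply: le_integrable (fi k) => //.
    by apply/measurable_EFinP; exact: measurableT_comp.
  move=> w _; rewrite /= lee_fin /fp ger0_norm ?le_max ?lexx ?orbT//.
  by rewrite ge_max normr_ge0 ler_norm.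
have ifn : P.-integrable setT (fun w => (fn (g k w))%:E).
  apply: le_integrable (fi k) => //.
    by apply/measurable_EFinP; exact: measurableT_comp.
  move=> w _; rewrite /= lee_fin /fn ger0_norm ?le_max ?lexx ?orbT//.
  by rewrite ge_max normr_ge0 -normrN ler_norm.
have mupd (u : R -> R) : measurable_fun setT u ->
    forall i, measurable_fun setT (upd u i).
  by move=> mu i; rewrite /upd; case: eqP.
have iupd (u : R -> R) : P.-integrable setT (fun w => (u (g k w))%:E) ->
    forall i, P.-integrable setT (fun w => (upd u i (g i w))%:E).
  by move=> iu i; rewrite /upd; case: eqP => [->|_].
have updE (u : R -> R) : measurable_fun setT u -> (forall x, 0 <= u x) ->
    P.-integrable setT (fun w => (u (g k w))%:E) ->
    \int[P]_w (u (g k w) * \prod_(i | i != k) f i (g i w)) =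
    (\int[P]_w u (g k w)) * \prod_(i | i != k) \int[P]_w f i (g i w).
  move=> mu u0 iu; have := IH (upd u) (mupd u mu) (iupd u iu).
  have -> : \prod_i \int[P]_w upd u i (g i w) =
      (\int[P]_w u (g k w)) * \prod_(i | i != k) \int[P]_w f i (g i w).
    rewrite (bigD1 k)//=; congr (_ * _).
      by apply: eq_Rintegral => w _; rewrite /upd eqxx.
    by apply: eq_bigr => i /negbTE ik; rewrite /upd ik.
  move=> <-.
    apply: eq_Rintegral => w _.
    rewrite [RHS](bigD1 k)//= [X in _ = X * _]/upd eqxx; congr (_ * _).
    by apply: eq_bigr => i /negbTE ik; rewrite /upd ik.
  move=> i; rewrite /upd; case: eqP => // /eqP ik iks.
  by apply: f0; rewrite inE negb_or ik.
have iM (u : R -> R) : measurable_fun setT u ->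
    P.-integrable setT (fun w => (u (g k w))%:E) ->
    P.-integrable setT
      (fun w => (u (g k w) * \prod_(i | i != k) f i (g i w))%:E).
  move=> mu iu; have := integrable_prod_indep (mupd u mu) (iupd u iu).
  apply: eq_integrable => // w _; rewrite (bigD1 k)//= {1}/upd eqxx.
  by congr (_ * _)%:E; apply: eq_bigr => i /negbTE ik; rewrite /upd ik.
rewrite [RHS](bigD1 k)//=.
have -> : \int[P]_w f k (g k w) = \int[P]_w fp (g k w) - \int[P]_w fn (g k w).
  by rewrite -RintegralB//; apply: eq_Rintegral => w _; rewrite fE.
rewrite mulrBl -!updE//; try by move=> x; rewrite le_max lexx orbT.
rewrite -RintegralB//; try exact: iM.
by apply: eq_Rintegral => w _; rewrite (bigD1 k)//= fE mulrBl.
Qed.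
End independence.

(** * Independent Gaussian coordinates of the random matrix *)

Section coordinates.
Local Open Scope classical_set_scope.
Context (R : realType) d (T : measurableType d) (P : probability T R) (n : nat).
Variables (b : 'I_n -> 'I_n -> R) (X : T -> 'M[R[i]]_n).
Hypothesis b_sym : forall i j, b i j = b j i.
Hypothesis hX : gaussian_hermitian P b X.
Local Notation I := ('I_n * 'I_n)%type.

(** An off-diagonal pair of conjugate entries has two real degrees of freedom:
    the index (i, j) below the diagonal stands for the real part of that
    entry, its mirror image (j, i) for the imaginary part of the same entry.
    *)
Definition gcoord (al : I) (w : T) : R :=
  if (al.2 <= al.1)%N then complex.Re (X w al.1 al.2)
  else complex.Im (X w al.2 al.1).

Definition gvar (al : I) : R :=
  if al.1 == al.2 then b al.1 al.2 ^+ 2 else b al.1 al.2 ^+ 2 / 2.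

Lemma gvar_ge0 al : 0 <= gvar al.
Proof. by rewrite /gvar; case: ifP => _; rewrite ?divr_ge0// sqr_ge0. Qed.

Lemma gcoord_law al : has_law_NR P (gcoord al) (gvar al).
Proof.
case: hX => _ _ hoff hdiag; case: al => i j; rewrite /gcoord /gvar /=.
case: (ltngtP j i) => [ji|ij|/val_inj->].
- have -> : (i == j) = false by apply/eqP => ij; rewrite ij ltnn in ji.
  by case: (hoff i j ji).
- have -> : (i == j) = false by apply/eqP => ij'; rewrite ij' ltnn in ij.
  by rewrite b_sym; case: (hoff j i ij).
- by rewrite eqxx; exact: hdiag.
Qed.

Let swap (al : I) : I := (al.2, al.1).

(** Independence of the entries is applied to rectangles, in which the real
    and the imaginary part are then separated by [indep2]. *)
Lemma gcoord_indep (A : I -> set R) : (forall al, measurable (A al)) ->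
  P [set w | forall al, A al (gcoord al w)] =
  (\prod_al P (gcoord al @^-1` A al))%E.
Proof.
move=> mA; case: hX => _ hind hoff _.
pose B (al : I) : set (R * R) :=
  A al `*` (if (al.2 < al.1)%N then A (swap al) else setT).
pose D : {set I} := [set ij : I | (ij.2 <= ij.1)%N]%SET.
have mB al : measurable (B al) by apply: measurableX => //; case: ifP.
have := hind D B (subxx _) mB.
have -> : \bigcap_(i in [set i | i \in D])
     ((@complex_pair R \o (fun w => X w i.1 i.2)) @^-1` B i) =
   [set w | forall al, A al (gcoord al w)].
  apply/seteqP; split => w /= H.
  - move=> [i j]; rewrite /gcoord /=; case: leqP => ij.
      by have [] := H (i, j); rewrite /= ?inE.
    have [] := H (j, i); first by rewrite /= inE ltnW.
    by rewrite /= ij.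
  - move=> [i j] /=; rewrite inE /= => ji; split.
      by have := H (i, j); rewrite /gcoord/= ji.
    rewrite /=; case: ltnP => // ji'.
    by have := H (j, i); rewrite /gcoord/= leqNgt ji'.
move=> ->.
have PB (al : I) : al \in D ->
   P ((@complex_pair R \o (fun w => X w al.1 al.2)) @^-1` B al) =
   (P (gcoord al @^-1` A al) *
     (if (al.2 < al.1)%N then P (gcoord (swap al) @^-1` A (swap al)) else 1))%E.
  case: al => i j; rewrite inE /= => ji.
  have gE : gcoord (i, j) = fun w => complex.Re (X w i j).
    by apply/funext => w; rewrite /gcoord/= ji.
  have [ji'|ij] := ltnP j i.
    have gE' : gcoord (j, i) = fun w => complex.Im (X w i j).
      by apply/funext => w; rewrite /gcoord/= leqNgt ji'.
    have [_ _ ind] := hoff i j ji'.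
    rewrite gE /swap/= gE' -ind//; congr (P _).
    by rewrite /B /= ji'; apply/seteqP; split.
  rewrite mule1 gE; congr (P _).
  rewrite /B /= ltnNge ij; apply/seteqP; split => w //=;
    by [move=> []|move=> ?; split].
rewrite (eq_bigr _ PB) big_split/= [RHS](bigID (fun al : I => al \in D))/=.
congr (_ * _)%E; rewrite -big_mkcondr/=.
rewrite [RHS](reindex swap); last by exists swap => -[].
apply: eq_bigl => -[i j]; rewrite !inE/= -ltnNge.
by rewrite andb_idl// => /ltnW.
Qed.

End coordinates.

(** * The Wick formula *)

Section pairings.

(** All pairings of the entries of [s], the earlier entry first in each pair.
    The recursive call is on [rem l s'], which is not a subterm of [s]; so
    recursion is on a bound [n] for the size of [s]. *)
Fixpoint pairings (n : nat) (s : seq nat) : seq (seq (nat * nat)) :=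
  match n, s with
  | _, [::] => [:: [::]]
  | 0, _ => [::]
  | n'.+1, k :: s' =>
      [seq (k, l) :: p | l <- s', p <- pairings n' (rem l s')]
  end.

Lemma size_rem_leq (l : nat) s n : l \in s -> (size s < n.+1)%N ->
  (size (rem l s) <= n)%N.
Proof.
by move=> ls sn; rewrite size_rem//; case: s ls sn => //= a s _ /ltnW.
Qed.

(** Iterating the recursion: the first entry is paired with some l, then the
    rest is paired in the same way. *)
Lemma sum_pairings (K : comNzRingType) (cov : nat -> nat -> K)
    (W : seq nat -> K) :
  W [::] = 1 ->
  (forall k s, uniq (k :: s) ->
     W (k :: s) = \sum_(l <- s) cov k l * W (rem l s)) ->
  forall n s, (size s <= n)%N -> uniq s ->
  W s = \sum_(p <- pairings n s) \prod_(kl <- p) cov kl.1 kl.2.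
Proof.
move=> W0 Wrec; elim=> [|n IH] [|k s] //= sn us;
  try by rewrite big_seq1 big_nil.
rewrite Wrec// big_allpairs_dep/= big_seq [RHS]big_seq; apply: eq_bigr => l ls.
have sr : (size (rem l s) <= n)%N by exact: size_rem_leq.
have ur : uniq (rem l s) by rewrite rem_uniq//; case/andP: us.
by rewrite (IH _ sr ur) mulr_sumr; apply: eq_bigr => p _; rewrite big_cons.
Qed.

Lemma pairings_ltn n s p :
  (size s <= n)%N -> sorted ltn s -> p \in pairings n s ->
  forall kl, kl \in p -> [/\ (kl.1 < kl.2)%N, kl.1 \in s & kl.2 \in s].
Proof.
elim: n s p => [|n IH] [|k s] p //= sn ss; try by rewrite inE => /eqP->.
move=> /allpairsPdep[l [q [ls qs ->]]] kl; rewrite inE => /predU1P[->|klq] /=.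
  rewrite !inE eqxx ls orbT; split => //.
  by move: ss; rewrite (path_sortedE ltn_trans) => /andP[/allP/(_ _ ls)].
have ss' : sorted ltn (rem l s).
  apply: (subseq_sorted ltn_trans (rem_subseq l s)).
  exact: path_sorted ss.
have [lt kl1 kl2] := IH _ _ (size_rem_leq ls sn) ss' qs _ klq.
by rewrite !inE (mem_rem kl1) (mem_rem kl2) !orbT.
Qed.

Lemma pairings_mem n s p : (size s <= n)%N -> p \in pairings n s ->
  forall k, k \in s -> (k \in unzip1 p) || (k \in unzip2 p).
Proof.
elim: n s p => [|n IH] [|k s] p //= sn.
move=> /allpairsPdep[l [q [ls qs ->]]] j; rewrite inE /= !inE.
move=> /predU1P[->|js]; first by rewrite eqxx.
have [->|jl] := eqVneq j l; first by rewrite !orbT.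
have jr : j \in rem l s.
  move: (perm_to_rem ls) => /perm_mem/(_ j); rewrite js inE (negbTE jl) /=.
  by move=> <-.
by have /orP[->|->] := IH _ _ (size_rem_leq ls sn) qs _ jr; rewrite !orbT.
Qed.

Lemma pairings_fst_uniq n s p : (size s <= n)%N -> sorted ltn s ->
  p \in pairings n s -> uniq (unzip1 p).
Proof.
elim: n s p => [|n IH] [|k s] p //= sn ss; try by rewrite inE => /eqP->.
move=> /allpairsPdep[l [q [ls qs ->]]] /=.
have sr := size_rem_leq ls sn.
have ssr : sorted ltn (rem l s).
  apply: (subseq_sorted ltn_trans (rem_subseq l s)).
  exact: path_sorted ss.
rewrite (IH _ _ sr ssr qs) andbT; apply/negP => /mapP[kl klq kE].
have [_ + _] := pairings_ltn sr ssr qs klq.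
rewrite -kE => /mem_rem ks; move: ss.
rewrite path_sortedE; last exact: ltn_trans.
by case/andP => /allP/(_ _ ks); rewrite /= ltnn.
Qed.

End pairings.

Section wick.
Context (K : comNzRingType) (I : finType).
Variables (v : I -> K) (c : nat -> I -> K) (mu : seq I -> K).
Hypothesis mu_perm : forall t t', perm_eq t t' -> mu t = mu t'.
Hypothesis mu_rec : forall a t,
  mu (a :: t) = v a * (count_mem a t)%:R * mu (rem a t).

(** With [mu t] the moment of the product of the Gaussian variables listed in
    [t], this is the moment of that product times the linear forms \sum_a c k
    a g_a, k in [s]. *)
Fixpoint word_moment (s : seq nat) (t : seq I) : K :=
  if s is k :: s' then \sum_a c k a * word_moment s' (a :: t) else mu t.

Lemma word_moment_perm s t t' : perm_eq t t' ->
  word_moment s t = word_moment s t'.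
Proof.
elim: s t t' => [|k s IH] t t' tt' /=; first exact: mu_perm.
by apply: eq_bigr => a _; congr (_ * _); apply: IH; rewrite perm_cons.
Qed.

(** Gaussian integration by parts, E[g_a F] = v_a E[dF/dg_a]: the derivative
    either removes one of the linear forms, leaving its coefficient [c l a],
    or one of the occurrences of [a] in [t]. *)
Lemma word_moment_by_parts s a t : uniq s ->
  word_moment s (a :: t) =
    \sum_(l <- s) v a * c l a * word_moment (rem l s) t +
    v a * (count_mem a t)%:R * word_moment s (rem a t).
Proof.
elim: s t => [|k s IH] t /=; first by rewrite big_nil add0r mu_rec.
move=> /andP[ks us].
have step b : word_moment s [:: b, a & t] =
    \sum_(l <- s) v a * c l a * word_moment (rem l s) (b :: t) +
    v a * (count_mem a (b :: t))%:R * word_moment s (rem a (b :: t)).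
  rewrite -IH//; apply: word_moment_perm.
  rewrite -[[:: b, a & t]]/([:: b] ++ a :: t) perm_catC /= perm_cons.
  by rewrite -cat1s perm_catC.
under eq_bigr do rewrite step mulrDr.
rewrite big_split/= big_cons eqxx -[RHS]addrA [RHS]addrCA; congr (_ + _).
  rewrite [RHS]big_seq; under eq_bigr do rewrite mulr_sumr.
  rewrite exchange_big /= big_seq; apply: eq_bigr => l ls.
  have -> : (k == l) = false by apply/negP => /eqP kl; rewrite kl ls in ks.
  by rewrite /= mulr_sumr; apply: eq_bigr => b _; rewrite mulrCA.
have Eb b : c k b * (v a * ((b == a) + count_mem a t)%:R *
      word_moment s (if b == a then t else b :: rem a t)) =
    (if b == a then c k a * v a * word_moment s t else 0) +
    v a * (count_mem a t)%:R * (c k b * word_moment s (b :: rem a t)).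
  case: eqVneq => [->|ba]; last by rewrite add0n add0r mulrCA mulrA.
  rewrite natrD mulrDr mulrDl mulrDr mulr1 mulrA; congr (_ + _).
  rewrite mulrCA; have [at_|at_] := boolP (a \in t); last first.
    by rewrite (count_memPn at_) !mulr0 !mul0r.
  by congr (_ * (_ * _)); apply: word_moment_perm; exact: perm_to_rem.
rewrite (eq_bigr _ (fun b _ => Eb b)) big_split/= -big_mkcond big_pred1_eq.
rewrite mulr_sumr.
by congr (_ + _); rewrite (mulrC (c k a)).
Qed.

Lemma word_moment_wick k s : uniq (k :: s) ->
  word_moment (k :: s) [::] =
  \sum_(l <- s) (\sum_a v a * c k a * c l a) * word_moment (rem l s) [::].
Proof.
move=> /= /andP[_ us].
under eq_bigr => a _.
  rewrite word_moment_by_parts// mulr0 mul0r addr0 mulr_sumr; over.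
rewrite exchange_big/=; apply: eq_bigr => l _.
rewrite mulr_suml; apply: eq_bigr => a _.
by rewrite !mulrA (mulrC (c k a)).
Qed.

End wick.

Section words.
Local Open Scope classical_set_scope.
Context {R : realType} (I : finType) (v : I -> R).

Definition real_word_moment (t : seq I) : R :=
  \prod_al gauss_moment (v al) (count_mem al t).

Lemma real_word_moment_perm t t' : perm_eq t t' ->
  real_word_moment t = real_word_moment t'.
Proof. by move=> /permP tt'; apply: eq_bigr => al _; rewrite tt'. Qed.

Lemma real_word_moment_rec al t : real_word_moment (al :: t) =
  v al * (count_mem al t)%:R * real_word_moment (rem al t).
Proof.
rewrite /real_word_moment (bigD1 al)//= eqxx add1n gauss_moment_rec.
rewrite [in RHS](bigD1 al)//= mulrA count_mem_rem eqxx subn1; congr (_ * _).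
apply: eq_bigr => be bal.
by rewrite count_mem_rem eq_sym (negbTE bal) subn0 add0n.
Qed.

Lemma prod_word (x : I -> R) (t : seq I) :
  \prod_(al <- t) x al = \prod_al x al ^+ count_mem al t.
Proof.
elim: t => [|a t IH]; first by rewrite big_nil big1.
rewrite big_cons IH [RHS](eq_bigr (fun al =>
  (if al == a then x al else 1) * x al ^+ count_mem al t)).
  by rewrite big_split/= -big_mkcond big_pred1_eq.
move=> al _; rewrite [count_mem al (a :: t)]/= exprD (eq_sym a).
by case: eqP; rewrite ?expr1 ?expr0.
Qed.

Context d (T : measurableType d) (P : probability T R) (g : I -> T -> R).
Hypothesis v0 : forall al, 0 <= v al.
Hypothesis glaw : forall al, has_law_NR P (g al) (v al).
Hypothesis gindep : forall A : I -> set R, (forall al, measurable (A al)) ->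
  P [set w | forall al, A al (g al w)] = (\prod_al P (g al @^-1` A al))%E.

Lemma expectation_word (t : seq I) :
  P.-integrable setT (fun w => (\prod_(al <- t) g al w)%:E) /\
  \int[P]_w (\prod_(al <- t) g al w) = real_word_moment t.
Proof.
pose f al (x : R) := x ^+ count_mem al t.
have mg al : measurable_fun setT (g al) by case: (glaw al).
have mf al : measurable_fun setT (f al) by exact: measurable_exprX.
have mom al := has_law_NR_moment (count_mem al t) (v0 al) (glaw al).
have fi al : P.-integrable setT (fun w => (f al (g al w))%:E) by case: (mom al).
have E w : \prod_(al <- t) g al w = \prod_al f al (g al w).
  exact: (prod_word (fun al => g al w)).
split.
  under eq_fun do rewrite E.
  exact: (integrable_prod_indep mg gindep mf fi).
under eq_Rintegral do rewrite E.
rewrite (expectation_prod_indep mg gindep mf fi); apply: eq_bigr => al _.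
by rewrite /Rintegral (mom al).2.
Qed.

End words.

(** * The contribution of one pairing *)

Section tuples.

Lemma sum_tuple_rcons (V : nmodType) (T : finType) m (F : seq T -> V) :
  \sum_(u : m.+1.-tuple T) F u = \sum_(u : m.-tuple T) \sum_i F (rcons u i).
Proof.
rewrite pair_bigA /=.
rewrite (reindex (fun p : m.-tuple T * T => [tuple of rcons p.1 p.2]))//=.
apply: onW_bij; apply: inj_card_bij.
  2: by rewrite card_prod !card_tuple expnSr.
by move=> [u i] [u' i'] /= /(congr1 val) /= /rcons_inj [/val_inj-> ->].
Qed.

(** Each position is sent to the least element of its class for the
    equivalence relation generated by [Q]: to impose one more identification
    of x with y, the greater of the representatives of x and y is redirected
    to the smaller one. *)
Lemma exists_class_rep (Q : seq (nat * nat)) (N : nat) :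
  (forall e, e \in Q -> (e.1 < N)%N && (e.2 < N)%N) ->
  exists r : nat -> nat, [/\ forall z, (r z <= z)%N, forall z, r (r z) = r z &
    forall (T : eqType) (u : nat -> T),
      (forall e, e \in Q -> u e.1 = u e.2) <->
      (forall z, (z < N)%N -> u z = u (r z))].
Proof.
elim: Q => [|[x y] Q IH] QN.
  by exists id; split => // T u; split.
have /andP[/= xN yN] : ((x, y).1 < N)%N && ((x, y).2 < N)%N.
  by apply: QN; rewrite mem_head.
have [|r [rle rr rP]] := IH.
  by move=> e eQ; apply: QN; rewrite inE eQ orbT.
pose p := minn (r x) (r y); pose q := maxn (r x) (r y).
have pq : (p <= q)%N by rewrite geq_min !leq_max leqnn.
have rpq : (r x = p /\ r y = q) \/ (r x = q /\ r y = p).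
  by rewrite /p /q; case: (leqP (r x) (r y)) => _; [left|right].
have [rp rq] : r p = p /\ r q = q.
  by case: rpq => -[<- <-]; rewrite !rr.
have qN : (q < N)%N.
  by rewrite gtn_max !(leq_ltn_trans (rle _)).
exists (fun z => if r z == q then p else r z); split.
- by move=> z; case: eqP => [zq|//]; rewrite (leq_trans pq)// -zq.
- move=> z; case: (eqVneq (r z) q) => [zq|zq]; first by rewrite rp; case: ifP.
  by rewrite rr (negbTE zq).
- move=> T u; split=> [uQ z zN|uz].
  + have uxy : u x = u y by apply: (uQ (x, y)); rewrite mem_head.
    have ur : forall z, (z < N)%N -> u z = u (r z).
      by apply/rP => e eQ; apply: uQ; rewrite inE eQ orbT.
    case: eqP => [zq|_]; last exact: ur.
    rewrite (ur _ zN) zq.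
    by case: rpq => -[<- <-]; rewrite -!ur.
  + have uqp : u q = u p by rewrite (uz q qN) rq eqxx.
    have ur z : (z < N)%N -> u z = u (r z).
      by move=> zN; rewrite (uz z zN); case: eqP => // ->.
    move=> e; rewrite inE => /predU1P[->/=|eQ]; last by apply/rP : e eQ.
    by rewrite (ur x)// (ur y)//; case: rpq => -[-> ->].
Qed.

End tuples.

Section bound.
Context (R : realFieldType).
Variables (r : nat -> nat) (opening : pred nat).
Hypothesis r_le : forall z, (r z <= z)%N.

(** [r] maps a position to the representative of its class, and [opening]
    selects the steps that come first in their pair. Only these carry the
    weight [a], so that each pair is counted once. *)
Definition walk_weight (T : finType) (x0 : T) (a : T -> T -> R) (m : nat)
    (u : seq T) : R :=
  \prod_(z < m.+1) (nth x0 u z == nth x0 u (r z))%:R *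
  \prod_(t < m | opening t) a (nth x0 u t) (nth x0 u t.+1).

Definition new_weight (D : R) (m : nat) : R :=
  \prod_(t < m) (if r t.+1 == t.+1 then D else 1).

(** Summing over the label of the last position: either that label is forced
    by the class of an earlier position, or the position is a new
    representative and its label is free. *)
Lemma sum_walk_weightS (T : finType) (x0 : T) (a : T -> T -> R) m :
  \sum_(u : m.+2.-tuple T) walk_weight x0 a m.+1 u =
  \sum_(u : m.+1.-tuple T) walk_weight x0 a m u *
    (let b i := if opening m then a (nth x0 u m) i else 1 in
     if r m.+1 == m.+1 then \sum_i b i else b (nth x0 u (r m.+1))).
Proof.
rewrite sum_tuple_rcons; apply: eq_bigr => u _ /=.
have nthu i z : (z <= m)%N -> nth x0 (rcons u i) z = nth x0 u z.
  by move=> zm; rewrite nth_rcons size_tuple ltnS zm.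
have nthl i : nth x0 (rcons u i) m.+1 = i.
  by rewrite nth_rcons size_tuple ltnn eqxx.
pose b i := if opening m then a (nth x0 u m) i else 1.
have E i : walk_weight x0 a m.+1 (rcons u i) = walk_weight x0 a m u *
    ((i == nth x0 (rcons u i) (r m.+1))%:R * b i).
  have lastE (g : nat -> R) : \prod_(t < m.+1 | opening t) g t =
      \prod_(t < m | opening t) g t * (if opening m then g m else 1).
    by rewrite big_mkcond big_ord_recr/= [in RHS]big_mkcond.
  rewrite /walk_weight big_ord_recr/= nthl.
  rewrite (lastE (fun t => a (nth x0 (rcons u i) t) (nth x0 (rcons u i) t.+1))).
  rewrite nthl (nthu i m (leqnn m)) -/(b i) mulrACA; congr (_ * _ * _).
    apply: eq_bigr => z _.
    by rewrite !nthu// -ltnS// (leq_ltn_trans (r_le _)).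
  by apply: eq_bigr => t _; rewrite !nthu// ltnW.
rewrite (eq_bigr _ (fun i _ => E i)) -mulr_sumr; congr (_ * _).
case: eqP => [->|/eqP rm].
  by apply: eq_bigr => i _; rewrite nthl eqxx mul1r.
rewrite (bigD1 (nth x0 u (r m.+1)))//= nthu; last first.
  by rewrite -ltnS ltn_neqAle rm r_le.
rewrite eqxx mul1r big1 ?addr0// => i /negbTE iu.
by rewrite nthu ?iu ?mul0r// -ltnS ltn_neqAle rm r_le.
Qed.

Lemma walk_weight_ge0 (T : finType) (x0 : T) (a : T -> T -> R) m u :
  (forall i j, 0 <= a i j) -> 0 <= walk_weight x0 a m u.
Proof. by move=> a0; rewrite mulr_ge0// prodr_ge0. Qed.

Lemma sum_walk_weight0 (T : finType) (x0 : T) (a : T -> T -> R) :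
  \sum_(u : 1.-tuple T) walk_weight x0 a 0 u = #|T|%:R.
Proof.
have r0 : r 0 = 0%N by apply/eqP; rewrite -leqn0.
under eq_bigr do rewrite /walk_weight big_ord1 big_ord0 r0 eqxx mulr1.
by rewrite sumr_const card_tuple expn1.
Qed.

Lemma sum_walk_weight_le (T : finType) (x0 : T) (a : T -> T -> R) (D : R) m :
  (forall i j, 0 <= a i j <= 1) -> (forall i, \sum_j a i j <= D) ->
  (forall t, (t < m)%N -> r t.+1 = t.+1 -> opening t) ->
  \sum_(u : m.+1.-tuple T) walk_weight x0 a m u <= #|T|%:R * new_weight D m.
Proof.
move=> a01 aD; elim: m => [|m IH] new.
  by rewrite sum_walk_weight0 /new_weight big_ord0 mulr1.
rewrite sum_walk_weightS /new_weight big_ord_recr/= mulrA -/(new_weight D m).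
set c := (if _ then D else 1).
have c0 : 0 <= c.
  rewrite /c; case: ifP => // _; rewrite (le_trans _ (aD x0))// sumr_ge0// => j _.
  by case/andP: (a01 x0 j).
apply: (@le_trans _ _ (\sum_(u : m.+1.-tuple T) walk_weight x0 a m u * c)).
  apply: ler_sum => u _; apply: ler_wpM2l.
    by apply: walk_weight_ge0 => i j; case/andP: (a01 i j).
  rewrite /= /c; case: eqP => [/(new m (ltnSn m)) ->|_]; first exact: aD.
  by case: ifP => // _; case/andP: (a01 (nth x0 u m) (nth x0 u (r m.+1))).
rewrite -mulr_suml ler_wpM2r// IH// => t tm; apply: new.
exact: ltnW.
Qed.

(** The case of equality in [sum_walk_weight_le]: all weights are 1 and each
    row sums to [#|T|]. *)
Lemma sum_walk_weight1 (T : finType) (x0 : T) m :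
  \sum_(u : m.+1.-tuple T) walk_weight x0 (fun _ _ => 1) m u =
  #|T|%:R * new_weight #|T|%:R m.
Proof.
elim: m => [|m IH].
  by rewrite sum_walk_weight0 /new_weight big_ord0 mulr1.
rewrite sum_walk_weightS /new_weight big_ord_recr/= mulrA -/(new_weight _ m).
rewrite -IH.
rewrite mulr_suml; apply: eq_bigr => u _; congr (_ * _).
by rewrite !if_same sumr_const.
Qed.

End bound.

Section pairing_bound.
Context (R : realFieldType).

Definition pairing_weight (T : finType) (x0 : T) (a : T -> T -> R)
    (p : seq (nat * nat)) (u : seq T) : R :=
  \prod_(kl <- p) (a (nth x0 u kl.1) (nth x0 u kl.1.+1) *
    ((nth x0 u kl.2, nth x0 u kl.2.+1) == (nth x0 u kl.1.+1, nth x0 u kl.1))%:R).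

(** Both sums are rewritten in terms of [walk_weight], with [r] computed from
    the identifications forced by [p] together with u_0 = u_m; they are then
    controlled by the same number [new_weight r #|S|%:R m]. A step that leads
    to a new class comes first in its pair, since the second step of a pair
    ends where the first one began. *)
Lemma sum_pairing_weight_le (T S : finType) (x0 : T) (y0 : S)
    (a : T -> T -> R) m p :
  (forall i j, 0 <= a i j <= 1) -> (forall i, \sum_j a i j <= #|S|%:R) ->
  p \in pairings m (iota 0 m) ->
  (#|T|%:R)^-1 * (\sum_(u : m.+1.-tuple T | nth x0 u 0 == nth x0 u m)
    pairing_weight x0 a p u) <=
  (#|S|%:R)^-1 * (\sum_(u : m.+1.-tuple S | nth y0 u 0 == nth y0 u m)
    pairing_weight y0 (fun _ _ => 1) p u).
Proof.
move=> a01 aD pP.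
have sm : (size (iota 0 m) <= m)%N by rewrite size_iota.
have ss : sorted ltn (iota 0 m) by exact: iota_ltn_sorted.
pose Q := (0%N, m) ::
  flatten [seq [:: (kl.1, kl.2.+1); (kl.1.+1, kl.2)] | kl <- p].
have lem kl : kl \in p -> [/\ (kl.1 < kl.2)%N, (kl.1 < m)%N & (kl.2 < m)%N].
  by move=> /(pairings_ltn sm ss pP)[? ]; rewrite !mem_iota !add0n.
have QP e : reflect (e = (0%N, m) \/ exists2 kl, kl \in p &
    e = (kl.1, kl.2.+1) \/ e = (kl.1.+1, kl.2)) (e \in Q).
  rewrite inE; apply: (iffP predU1P) => -[->|]; try by left.
    move=> /flatten_mapP[kl klp]; rewrite !inE => /orP[]/eqP->;
      right; exists kl => //.
      by left.
    by right.
  move=> [kl klp ee]; right; apply/flatten_mapP; exists kl => //.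
  by case: ee => ->; rewrite !inE eqxx ?orbT.
have QN e : e \in Q -> (e.1 < m.+1)%N && (e.2 < m.+1)%N.
  move=> /QP[->|[kl /lem[h1 h2 h3] [] -> /=]]; first by rewrite /= ltnSn.
    by rewrite !ltnS h3 ltnW.
  by rewrite !ltnS h2 ltnW.
have [r [r_le rr rP]] := exists_class_rep QN.
(* r is itself a labelling that is constant on classes *)
have rQ e : e \in Q -> r e.1 = r e.2.
  by apply: (rP _ r).2 => z _; rewrite rr.
pose F t := t \in unzip1 p.
have new t : (t < m)%N -> r t.+1 = t.+1 -> F t.
  move=> tm rt.
  have : (t \in unzip1 p) || (t \in unzip2 p).
    by apply: (pairings_mem sm pP); rewrite mem_iota.
  move=> /orP[//|/mapP[kl klp tE]].
  have : r kl.1 = r kl.2.+1.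
    by apply: (rQ (kl.1, kl.2.+1)); apply/QP; right; exists kl => //; left.
  rewrite -tE rt => E; have := r_le kl.1; rewrite E.
  have [lt _ _] := lem _ klp; rewrite -tE in lt; move=> le.
  by have := leq_trans le (ltnW lt); rewrite ltnn.
have WE (T' : finType) (z0 : T') (b : T' -> T' -> R) (u : seq T') :
    (if nth z0 u 0 == nth z0 u m then pairing_weight z0 b p u else 0) =
    walk_weight r F z0 b m u.
  rewrite /pairing_weight big_split/= /walk_weight.
  have -> : \prod_(kl <- p) b (nth z0 u kl.1) (nth z0 u kl.1.+1) =
      \prod_(t < m | F t) b (nth z0 u t) (nth z0 u t.+1).
    rewrite -(big_mkord F (fun t => b (nth z0 u t) (nth z0 u t.+1))).
    rewrite -(big_map fst predT (fun t => b (nth z0 u t) (nth z0 u t.+1))).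
    rewrite -[RHS]big_filter; apply: perm_big; apply: uniq_perm.
    - exact: pairings_fst_uniq pP.
    - by rewrite filter_uniq// iota_uniq.
    move=> t; rewrite mem_filter mem_index_iota leq0n /= /F.
    apply/idP/idP => [tp|/andP[]//]; rewrite tp/=.
    by case/mapP : tp => kl /lem[_ + _] ->.
  rewrite mulrC.
  have [allr|nallr] := boolP [forall z : 'I_m.+1, nth z0 u z == nth z0 u (r z)].
    have uQ : forall e, e \in Q -> nth z0 u e.1 = nth z0 u e.2.
      apply/(rP _ (nth z0 u)) => z zm.
      by have /forallP/(_ (Ordinal zm))/eqP := allr.
    have -> : nth z0 u 0 = nth z0 u m by apply: (uQ (0%N, m)); exact: mem_head.
    rewrite eqxx; congr (_ * _); rewrite !big1_seq//.
      by move=> z _; have /forallP/(_ z) -> := allr.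
    move=> kl /= klp; have -> : nth z0 u kl.2 = nth z0 u kl.1.+1.
      apply/esym; apply: (uQ (kl.1.+1, kl.2)); apply/QP.
      by right; exists kl => //; right.
    have -> : nth z0 u kl.2.+1 = nth z0 u kl.1.
      apply/esym; apply: (uQ (kl.1, kl.2.+1)); apply/QP.
      by right; exists kl => //; left.
    by rewrite eqxx.
  have [z /negbTE zr] : exists z : 'I_m.+1, nth z0 u z != nth z0 u (r z).
    by apply/existsP; rewrite -negb_forall.
  rewrite (bigD1 z)//= zr !mul0r.
  case: eqP => // u0m.
  have [e eQ ue] : exists2 e, e \in Q & nth z0 u e.1 != nth z0 u e.2.
    apply/hasP; apply: contraT; rewrite -all_predC => /allP H.
    have : forall z, (z < m.+1)%N -> nth z0 u z = nth z0 u (r z).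
      by apply/(rP _ (nth z0 u)) => e /H /negPn/eqP.
    by move=> /(_ z (ltn_ord z)) /eqP; rewrite zr.
  case/QP : eQ ue => [->|[kl klp ee]]; first by rewrite /= u0m eqxx.
  move=> ue; rewrite (big_rem kl)//= xpair_eqE.
  case: ee ue => -> /=; rewrite eq_sym => /negbTE ->; rewrite ?andbF ?mul0r//.
have cT : 0 < #|T|%:R :> R by rewrite ltr0n; apply/card_gt0P; exists x0.
have cS : 0 < #|S|%:R :> R by rewrite ltr0n; apply/card_gt0P; exists y0.
rewrite [X in _ * X <= _]big_mkcond [X in _ <= _ * X]big_mkcond.
rewrite (eq_bigr _ (fun u _ => WE _ x0 a (val u))).
rewrite (eq_bigr _ (fun u _ => WE _ y0 (fun _ _ => 1) (val u))).
rewrite sum_walk_weight1// mulKf ?gt_eqF// ler_pdivrMl//.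
exact: sum_walk_weight_le.
Qed.

End pairing_bound.

(** * Complex expectations, traces and closed walks *)

Section complex_expectation.
Local Open Scope classical_set_scope.
Context {R : realType} d (T : measurableType d) (P : probability T R).

Definition has_complex_mean (Z : T -> R[i]) (z : R[i]) :=
  [/\ P.-integrable setT (fun w => (complex.Re (Z w))%:E),
      P.-integrable setT (fun w => (complex.Im (Z w))%:E),
      \int[P]_w complex.Re (Z w) = complex.Re z &
      \int[P]_w complex.Im (Z w) = complex.Im z].

Lemma has_complex_mean_real (U : T -> R) (m : R) :
  P.-integrable setT (fun w => (U w)%:E) -> \int[P]_w U w = m ->
  has_complex_mean (fun w => (U w)%:C) m%:C.
Proof.
move=> iU UE; split => //=; first exact: integrable0.
by rewrite /Rintegral integral0.
Qed.

Lemma ReM (x y : R[i]) : complex.Re (x * y) =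
  complex.Re x * complex.Re y - complex.Im x * complex.Im y.
Proof. by case: x y => [? ?] [? ?]. Qed.

Lemma ImM (x y : R[i]) : complex.Im (x * y) =
  complex.Re x * complex.Im y + complex.Im x * complex.Re y.
Proof. by case: x y => [? ?] [? ?]. Qed.

Lemma has_complex_meanM (c : R[i]) Z z :
  has_complex_mean Z z -> has_complex_mean (fun w => c * Z w) (c * z).
Proof.
case=> i1 i2 e1 e2.
have iZl (k : R) (U : T -> R) : P.-integrable setT (fun w => (U w)%:E) ->
    P.-integrable setT (fun w => (k * U w)%:E).
  by move=> iU; have := integrableZl measurableT k iU.
split.
- under eq_fun do rewrite ReM.
  by have := integrableB measurableT
    (iZl (complex.Re c) _ i1) (iZl (complex.Im c) _ i2).
- under eq_fun do rewrite ImM.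
  by have := integrableD measurableT
    (iZl (complex.Re c) _ i2) (iZl (complex.Im c) _ i1).
- under eq_Rintegral do rewrite ReM.
  by rewrite RintegralB//; [rewrite !RintegralZl// e1 e2 ReM|exact: iZl..].
- under eq_Rintegral do rewrite ImM.
  by rewrite RintegralD//; [rewrite !RintegralZl// e1 e2 ImM|exact: iZl..].
Qed.

Lemma has_complex_meanD Z z Z' z' :
  has_complex_mean Z z -> has_complex_mean Z' z' ->
  has_complex_mean (fun w => Z w + Z' w) (z + z').
Proof.
case=> i1 i2 e1 e2 [i1' i2' e1' e2'].
have ReD (x y : R[i]) : complex.Re (x + y) = complex.Re x + complex.Re y.
  by case: x y => [? ?] [? ?].
have ImD (x y : R[i]) : complex.Im (x + y) = complex.Im x + complex.Im y.
  by case: x y => [? ?] [? ?].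
split.
- under eq_fun do rewrite ReD.
  by have := integrableD measurableT i1 i1'.
- under eq_fun do rewrite ImD.
  by have := integrableD measurableT i2 i2'.
- under eq_Rintegral do rewrite ReD.
  by rewrite RintegralD// e1 e1' ReD.
- under eq_Rintegral do rewrite ImD.
  by rewrite RintegralD// e2 e2' ImD.
Qed.

Lemma has_complex_mean_sum (J : Type) (r : seq J) (Q : pred J)
    (Z : J -> T -> R[i]) z :
  (forall j, has_complex_mean (Z j) (z j)) ->
  has_complex_mean (fun w => \sum_(j <- r | Q j) Z j w)
    (\sum_(j <- r | Q j) z j).
Proof.
move=> Zz; elim: r => [|j r IH].
  rewrite big_nil; under eq_fun do rewrite big_nil.
  apply: (@has_complex_mean_real (cst 0) 0); first exact: integrable0.
  by rewrite /Rintegral integral0.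
rewrite big_cons; under eq_fun do rewrite big_cons.
case: (Q j) => //; exact: has_complex_meanD.
Qed.

End complex_expectation.

Section trace.
Context (K : comNzRingType) (n : nat) (x0 : 'I_n) (M : 'M[K]_n).

(** The weight [G] of the two endpoints makes the induction on the length
    work; closed walks are the case of the Kronecker delta. *)
Lemma sum_walks (G : 'I_n -> 'I_n -> K) m :
  \sum_(u : m.+1.-tuple 'I_n) G (nth x0 u 0) (nth x0 u m) *
     \prod_(k < m) M (nth x0 u k) (nth x0 u k.+1) =
  \sum_i \sum_j G i j * (M ^+ m) i j.
Proof.
elim: m G => [|m IH] G.
  rewrite (sum_tuple_rcons 0 (fun u => G (nth x0 u 0) (nth x0 u 0) *
     \prod_(k < 0) M (nth x0 u k) (nth x0 u k.+1))).
  rewrite (big_pred1 [tuple]) => [|u]; last first.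
    by apply/esym/eqP/val_inj; case: u => -[].
  apply: eq_bigr => i _ /=; rewrite big_ord0 mulr1.
  rewrite (bigD1 i)//= expr0 mxE eqxx mulr1 big1 ?addr0// => j ji.
  by rewrite mxE eq_sym (negbTE ji) mulr0.
rewrite (sum_tuple_rcons m.+1 (fun u => G (nth x0 u 0) (nth x0 u m.+1) *
     \prod_(k < m.+1) M (nth x0 u k) (nth x0 u k.+1))).
have E (u : m.+1.-tuple 'I_n) :
   \sum_i G (nth x0 (rcons u i) 0) (nth x0 (rcons u i) m.+1) *
     \prod_(k < m.+1) M (nth x0 (rcons u i) k) (nth x0 (rcons u i) k.+1) =
   (\sum_i G (nth x0 u 0) i * M (nth x0 u m) i) *
    \prod_(k < m) M (nth x0 u k) (nth x0 u k.+1).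
  rewrite mulr_suml; apply: eq_bigr => i _.
  have nthu z : (z <= m)%N -> nth x0 (rcons u i) z = nth x0 u z.
    by move=> zm; rewrite nth_rcons size_tuple ltnS zm.
  have nthl : nth x0 (rcons u i) m.+1 = i.
    by rewrite nth_rcons size_tuple ltnn eqxx.
  rewrite big_ord_recr/= nthl !nthu// mulrAC mulrA; congr (_ * _ * _).
  by apply: eq_bigr => k _; rewrite !nthu// ltnW.
rewrite (eq_bigr _ (fun u _ => E u)).
rewrite (IH (fun i j => \sum_k G i k * M j k)); apply: eq_bigr => i _.
under eq_bigr do rewrite mulr_suml.
rewrite exchange_big/=; apply: eq_bigr => j _.
rewrite exprSr -mulmxE mxE mulr_sumr; apply: eq_bigr => k _.
by rewrite -mulrA (mulrC (M k j)).
Qed.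

Lemma trace_walks m :
  \tr (M ^+ m) = \sum_(u : m.+1.-tuple 'I_n | nth x0 u 0 == nth x0 u m)
     \prod_(k <- iota 0 m) M (nth x0 u k) (nth x0 u k.+1).
Proof.
rewrite big_mkcond/=.
rewrite (eq_bigr (fun u : m.+1.-tuple 'I_n => (nth x0 u 0 == nth x0 u m)%:R *
     \prod_(k < m) M (nth x0 u k) (nth x0 u k.+1))); last first.
  move=> u _.
  rewrite -(big_mkord predT (fun k => M (nth x0 u k) (nth x0 u k.+1))).
  by rewrite /index_iota subn0; case: ifP => _; rewrite ?mul1r ?mul0r.
rewrite (sum_walks (fun i j => (i == j)%:R)) /mxtrace; apply: eq_bigr => i _.
rewrite (bigD1 i)//= eqxx mul1r big1 ?addr0// => j ji.
by rewrite eq_sym (negbTE ji) mul0r.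
Qed.
End trace.

Section coef.
Context (R : realType) (n : nat).
Local Notation I := ('I_n * 'I_n)%type.
Variables (b : 'I_n -> 'I_n -> R).
Hypothesis b_sym : forall i j, b i j = b j i.

(** The coefficients of the entry [e] as a linear form in the real
    coordinates. *)
Definition gcoef (e al : I) : R[i] :=
  if e.1 == e.2 then (al == e)%:R
  else if (e.2 < e.1)%N then (al == e)%:R + (al == (e.2, e.1))%:R * 'i%C
  else (al == (e.2, e.1))%:R - (al == e)%:R * 'i%C.

Lemma sum_gcoef (e : I) (F : I -> R[i]) : \sum_al gcoef e al * F al =
  if e.1 == e.2 then F e
  else if (e.2 < e.1)%N then F e + 'i%C * F (e.2, e.1)
  else F (e.2, e.1) - 'i%C * F e.
Proof.
have D (a : I) (c : R[i]) : \sum_al (al == a)%:R * c * F al = c * F a.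
  rewrite (bigD1 a)//= eqxx mul1r big1 ?addr0// => al /negbTE ->.
  by rewrite !mul0r.
rewrite /gcoef; case: ifP => _.
  by rewrite -[RHS]mul1r -D; under [RHS]eq_bigr do rewrite mulr1.
case: ifP => _.
  rewrite -(mul1r (F e)) -!D -big_split/=.
  by apply: eq_bigr => al _; rewrite mulr1 mulrDl.
rewrite -(mul1r (F (e.2, e.1))) -!D -sumrB.
by apply: eq_bigr => al _; rewrite mulr1 mulrBl.
Qed.

(** An off-diagonal entry X_ij = x + i y has E[X_ij X_ij] = E[x^2] - E[y^2] =
    0, whereas E[X_ij X_ji] = E[x^2] + E[y^2] = b_ij^2. *)
Lemma gcoef_cov (e e' : I) :
  \sum_al (gvar b al)%:C * gcoef e al * gcoef e' al =
  (b e.1 e.2 ^+ 2 * (e' == (e.2, e.1))%:R)%:C.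
Proof.
under eq_bigr do rewrite -mulrA mulrCA.
rewrite (sum_gcoef e (fun al => (gvar b al)%:C * gcoef e' al)).
have ii : 'i%C * 'i%C = -1 :> R[i] by rewrite -expr2 sqr_i.
have natC (x : R) (c : bool) : (x * c%:R)%:C = x%:C * c%:R.
  by case: c; rewrite ?mulr1 ?mulr0.
have half (x : R) : (x / 2)%:C + (x / 2)%:C = x%:C.
  by rewrite -rmorphD/=; congr (_%:C); lra.
case: e e' => i j [k l] /=.
have gcoef0 al : al != (k, l) -> al != (l, k) -> gcoef (k, l) al = 0.
  rewrite /gcoef /= => /negbTE-> /negbTE->.
  by case: ifP => _ //; case: ifP => _; rewrite mul0r ?addr0 ?subr0.
have [<-{j}|ij] := eqVneq i j.
  rewrite /gvar /= eqxx natC; congr (_ * _).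
  have [->|kl] := eqVneq (k, l) (i, i); first by rewrite /gcoef /= !eqxx.
  rewrite gcoef0// eq_sym//; apply: contraNneq kl => -[-> ->]; exact: eqxx.
have vE : gvar b (i, j) = b i j ^+ 2 / 2 by rewrite /gvar /= (negbTE ij).
have vE' : gvar b (j, i) = b i j ^+ 2 / 2.
  by rewrite /gvar /= eq_sym (negbTE ij) b_sym.
have neq : ((i, j) == (j, i)) = false by rewrite xpair_eqE (negbTE ij).
have neq' : ((j, i) == (i, j)) = false by rewrite eq_sym neq.
have ij' : (i == j) = false by exact/negbTE.
have ji' : (j == i) = false by rewrite eq_sym.
rewrite vE vE' natC.
have [klE|kl1] := eqVneq (k, l) (j, i).
  move: klE => [-> ->].
  rewrite /gcoef /= !eqxx neq neq' ji' mulr1 -(half (b i j ^+ 2)).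
  have [ji|ij1|/val_inj/eqP] := ltngtP j i; last by rewrite ji'.
  - rewrite mul0r subr0 mulr1 sub0r mul1r; congr (_ + _).
    by rewrite mulrCA mulrN ii opprK mulr1.
  - rewrite mul0r addr0 add0r mulr1 mul1r; congr (_ + _).
    by rewrite mulrCA ii mulrN1 opprK.
rewrite mulr0; have [klE|kl2] := eqVneq (k, l) (i, j).
  move: klE => [-> ->]; rewrite /gcoef /= !eqxx neq neq' ij'.
  have [ji|ij1|/val_inj/eqP] := ltngtP j i; last by rewrite ji'.
  - by rewrite mul0r addr0 add0r mul1r mulr1 mulrCA ii mulrN1 subrr.
  - by rewrite mul0r subr0 sub0r mul1r mulr1 mulrCA mulrN ii opprK mulr1 subrr.
rewrite !gcoef0 ?mulr0 ?addr0 ?subr0 ?if_same//.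
- by rewrite eq_sym.
- by apply: contraNneq kl2 => -[-> ->]; exact: eqxx.
- by rewrite eq_sym.
- by apply: contraNneq kl1 => -[-> ->]; exact: eqxx.
Qed.

End coef.

Section hermitian_moments.
Context (R : realType) d (T : measurableType d) (P : probability T R) (n : nat).
Variables (b : 'I_n -> 'I_n -> R) (X : T -> 'M[R[i]]_n).
Hypothesis b_sym : forall i j, b i j = b j i.
Hypothesis hX : gaussian_hermitian P b X.
Variable x0 : 'I_n.
Local Notation g := (gcoord X).
Local Notation v := (gvar b).

Lemma entry_gcoord w i j : X w i j = \sum_al gcoef R (i, j) al * (g al w)%:C.
Proof.
have [herm _ _ _] := hX.
rewrite (sum_gcoef (i, j) (fun al => (g al w)%:C)) /gcoord /=.
have [<-|ij] := eqVneq i j.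
  rewrite leqnn; have := herm w i i; case: (X w i i) => x y [] /eqP.
  by rewrite -addr_eq0 -mulr2n mulrn_eq0 /= => /eqP ->.
case: (ltngtP j i) => [ji|ij'|/val_inj ji]; last by rewrite ji eqxx in ij.
  by rewrite -complexE.
rewrite herm; case: (X w j i) => x y; by simpc.
Qed.

Let muC (t : seq ('I_n * 'I_n)) : R[i] := (real_word_moment v t)%:C.
Let c (u : nat -> 'I_n) (k : nat) := gcoef R (u k, u k.+1).

Lemma walk_mean (u : nat -> 'I_n) s t :
  has_complex_mean P
    (fun w => \prod_(k <- s) X w (u k) (u k.+1) * (\prod_(al <- t) g al w)%:C)
    (word_moment (c u) muC s t).
Proof.
elim: s t => [|k s IH] t /=.
  under eq_fun do rewrite big_nil mul1r.
  have [it Et] := expectation_word (gvar_ge0 b) (gcoord_law b_sym hX)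
    (gcoord_indep hX) t.
  exact: has_complex_mean_real.
have E w :
    \prod_(j <- k :: s) X w (u j) (u j.+1) * (\prod_(al <- t) g al w)%:C =
    \sum_al c u k al * (\prod_(j <- s) X w (u j) (u j.+1) *
      (\prod_(be <- al :: t) g be w)%:C).
  rewrite big_cons entry_gcoord -mulrA mulr_suml; apply: eq_bigr => al _.
  by rewrite big_cons rmorphM/= -mulrA; congr (_ * _); rewrite mulrCA.
under eq_fun do rewrite E.
by apply: has_complex_mean_sum => al; apply: has_complex_meanM; exact: IH.
Qed.

Lemma walk_mean_pairings (u : nat -> 'I_n) m :
  word_moment (c u) muC (iota 0 m) [::] =
  (\sum_(p <- pairings m (iota 0 m)) \prod_(kl <- p)
    (b (u kl.1) (u kl.1.+1) ^+ 2 *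
     ((u kl.2, u kl.2.+1) == (u kl.1.+1, u kl.1))%:R))%:C.
Proof.
pose cov k l : R[i] := (b (u k) (u k.+1) ^+ 2 *
     ((u l, u l.+1) == (u k.+1, u k))%:R)%:C.
rewrite (@sum_pairings _ cov (fun s => word_moment (c u) muC s [::]) _ _ m);
  last 4 first.
- rewrite /= /muC /real_word_moment big1//.
- move=> k s us.
  rewrite (@word_moment_wick _ _ (fun al => (v al)%:C) (c u) muC)//.
  + by apply: eq_bigr => l _; rewrite /c gcoef_cov.
  + by move=> t t' tt'; rewrite /muC (real_word_moment_perm _ tt').
  + by move=> al t; rewrite /muC real_word_moment_rec !rmorphM/= rmorph_nat.
- by rewrite size_iota.
- exact: iota_uniq.
rewrite rmorph_sum/=; apply: eq_bigr => p _; rewrite rmorph_prod.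
by apply: eq_bigr.
Qed.

Lemma Etr_pow_pairings m : Etr_pow P X m =
  (\sum_(p <- pairings m (iota 0 m)) n%:R^-1 *
     \sum_(u : m.+1.-tuple 'I_n | nth x0 u 0 == nth x0 u m)
       pairing_weight x0 (fun i j => b i j ^+ 2) p u)%:E.
Proof.
have H : has_complex_mean P (fun w => ntr (X w ^+ m))
    ((n%:R^-1 * \sum_(u : m.+1.-tuple 'I_n | nth x0 u 0 == nth x0 u m)
       \sum_(p <- pairings m (iota 0 m))
         pairing_weight x0 (fun i j => b i j ^+ 2) p u)%:C).
  rewrite rmorphM/= fmorphV/= rmorph_nat rmorph_sum/=.
  rewrite /ntr; apply: has_complex_meanM.
  under eq_fun do rewrite (trace_walks x0).
  apply: has_complex_mean_sum => u.
  have := walk_mean (nth x0 u) (iota 0 m) [::].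
  rewrite walk_mean_pairings.
  by under eq_fun do rewrite big_nil mulr1.
case: H => i1 _ e1 _; rewrite /Etr_pow expectation.unlock.
rewrite -[LHS]fineK; last exact: integrable_fin_num.
congr EFin.
rewrite -[LHS]/(Rintegral P setT (fun w => complex.Re (ntr (X w ^+ m)))) e1.
by rewrite /= exchange_big/= mulr_sumr.
Qed.

End hermitian_moments.

(** * Comparison of the two expansions *)

Theorem theorem2p2 (R : realType) (n d : nat)
  (b : 'I_n -> 'I_n -> R)
  (b_ge0 : forall i j, 0 <= b i j)
  (b_sym : forall i j, b i j = b j i)
  (dX : measure_display) (TX : measurableType dX) (PX : probability TX R)
  (X : TX -> 'M[R[i]]_n)
  (hX : gaussian_hermitian PX b X)
  (hstar : sigma_star2 b = 1)
  (hsigma : sigma2 b <= d%:R)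
  (dY : measure_display) (TY : measurableType dY) (PY : probability TY R)
  (Y : TY -> 'M[R[i]]_d)
  (hY : gaussian_hermitian PY (fun _ _ => 1) Y)
  (p : nat) :
  (Etr_pow PX X (2 * p) <= Etr_pow PY Y (2 * p))%E.
Proof.
have rowd i : \sum_j b i j ^+ 2 <= d%:R.
  apply: le_trans hsigma.
  exact: (le_bigmax 0 (fun i => \sum_j b i j ^+ 2) i).
have b2_ge0 i j : 0 <= b i j ^+ 2 by exact: sqr_ge0.
have b2_le1 i j : b i j ^+ 2 <= 1.
  rewrite -hstar.
  apply: le_trans (le_bigmax 0 (fun i => \big[Num.max/0]_j b i j ^+ 2) i).
  exact: (le_bigmax 0 (fun j => b i j ^+ 2) j).
have b2_le_d i j : b i j ^+ 2 <= d%:R.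
  by apply: le_trans (rowd i); rewrite (bigD1 j)//= lerDl sumr_ge0.
have d_gt0 : (0 < d)%N.
  rewrite lt0n; apply: contraPneq hstar => d0; apply/eqP; rewrite lt_eqF//.
  apply: (@le_lt_trans _ _ 0); last exact: ltr01.
  apply: bigmax_le => // i _; apply: bigmax_le => // j _.
  by rewrite (le_trans (b2_le_d i j))// d0.
have n_gt0 : (0 < n)%N.
  rewrite lt0n; apply: contraPneq hstar => n0; apply/eqP; rewrite lt_eqF//.
  subst n; rewrite /sigma_star2 big_ord0; exact: ltr01.
pose x0 : 'I_n := Ordinal n_gt0; pose y0 : 'I_d := Ordinal d_gt0.
rewrite (Etr_pow_pairings b_sym hX x0).
have Ysym : forall i j : 'I_d,
  (fun _ _ => 1) i j = (fun _ _ => 1) j i :> R by [].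
rewrite (Etr_pow_pairings Ysym hY y0) lee_fin.
rewrite big_seq [leRHS]big_seq; apply: ler_sum => q qP.
have := @sum_pairing_weight_le R _ _ x0 y0 (fun i j => b i j ^+ 2) (2 * p) q.
rewrite !card_ord; move=> /(_ _ _ qP) H.
under [X in _ <= _ * X]eq_bigr.
  move=> u _; rewrite (_ : pairing_weight _ _ _ _ =
    pairing_weight y0 (fun _ _ => 1) q u); last first.
    by apply: eq_bigr => kl _; rewrite expr1n.
  over.
by apply: H => // i j; rewrite b2_ge0 b2_le1.
Qed.
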